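(* Consider the iid Gaussian location model with $n$ hypotheses, $m=n^{1-s}$ signals and shift $\mu=\sqrt{2r\log n}$, with parameters $(s,r)$ satisfying $0<s<r<1$. Suppose that there exists a constant $c>0$ such that for all $n\ge1$ there is an $(\alpha_n,\beta_n)$-controlled top-$K$ procedure with $\alpha_n=c\,n^{-\kappa_\alpha}$ and $\beta_n=c\,n^{-\kappa_\beta}$. Then we must have $$\sqrt{s+\kappa_\alpha}+\sqrt{\kappa_\beta}\le\sqrt r\qquad\text{and}\qquad \min\{\kappa_\alpha,\kappa_\beta\}\le\frac{(r-s)^2}{4r}.$$
   Context: $[n]=\{1,\dots,n\}$ is partitioned into a set $\mathcal{H}_0$ of nulls and a set $\mathcal{H}_1$ of signals with $m=\mathrm{card}(\mathcal{H}_1)$. In the iid Gaussian location model with shift $\mu>0$, $W_1,\dots,W_n$ are iid standard Gaussian, and the observed statistics are $X_i=W_i$ for $i\in\mathcal{H}_0$ and $X_i=W_i+\mu$ for $i\in\mathcal{H}_1$. A top-$K$ procedure rejects the hypotheses corresponding to the top $K$ statistics, where $K=K_n(X_1,\dots,X_n)$ is a (possibly randomized) non-negative integer that may depend on the observed statistics; its discovery set is $\mathcal{I}=\{i\in[n]:X_i\ge X_{(K)}\}$, where $X_{(k)}$ is the $k$-th largest of $X_1,\dots,X_n$. Define $$\mathrm{FDR}=\mathbb{E}\Big[\frac{\mathrm{card}(\mathcal{I}\cap\mathcal{H}_0)}{\max\{\mathrm{card}(\mathcal{I}),1\}}\Big],\qquad \mathrm{FNR}=\mathbb{E}\Big[\frac{\mathrm{card}(\mathcal{I}^c\cap\mathcal{H}_1)}{\mathrm{card}(\mathcal{H}_1)}\Big].$$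 For a pair $(\alpha,\beta)\in[0,1]\times[0,1]$, a top-$K$ procedure is $(\alpha,\beta)$-controlled if $\mathrm{FDR}\le\alpha$ and $\mathrm{FNR}\le\beta$. The exponents $\kappa_\alpha,\kappa_\beta$ are scalars not depending on $n$.
   Formalization: The levels c n^{-κ_α} and c n^{-κ_β} are required to be < 1 for all large n; this excludes c=1 with a zero exponent, where rejecting everything (or nothing) refutes the claim. Also, m=n^{1-s} is read up to rounding, |m-n^{1-s}|<1. *)

(* Defs.v *)
From HB Require Import structures.
From mathcomp Require Import all_boot all_order all_algebra.
From mathcomp Require Import all_classical all_reals all_analysis.

Set Implicit Arguments.
Unset Strict Implicit.
Unset Printing Implicit Defensive.
Import Order.TTheory GRing.Theory Num.Theory.
Import numFieldNormedType.Exports.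
Local Open Scope classical_set_scope.
Local Open Scope ring_scope.

Definition mutually_independent (R : realType) d (T : measurableType d)
    (P : probability T R) n (W : 'I_n -> {RV P >-> R}) : Prop :=
  forall (J : {set 'I_n}) (A : 'I_n -> set R),
    (forall i, i \in J -> measurable (A i)) ->
    P (\bigcap_(i in [set i | i \in J]) W i @^-1` A i) =
    (\prod_(i in J) P (W i @^-1` A i))%E.

Definition independent_RV2 (R : realType) d d1 d2 (T : measurableType d)
    (T1 : measurableType d1) (T2 : measurableType d2)
    (P : probability T R) (X : T -> T1) (Y : T -> T2) : Prop :=
  forall (A : set T1) (B : set T2), measurable A -> measurable B ->
    P (X @^-1` A `&` Y @^-1` B) = (P (X @^-1` A) * P (Y @^-1` B))%E.

Definition iid_std_gaussian (R : realType) d (T : measurableType d)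
    (P : probability T R) n (W : 'I_n -> {RV P >-> R}) : Prop :=
  mutually_independent W /\
  forall i (A : set R), measurable A ->
    distribution P (W i) A = normal_prob 0 1 A.

(* The set [H1] contains the signals; the nulls are [~: H1]. *)
Definition observed (R : realType) d (T : measurableType d)
    (P : probability T R) n (H1 : {set 'I_n}) (mu : R)
    (W : 'I_n -> {RV P >-> R}) (w : T) : n.-tuple R :=
  [tuple if i \in H1 then W i w + mu else W i w | i < n].

(* [order_stat x k] is the k-th largest entry of x when 1 <= k <= n.  It is
   +oo for k = 0 and -oo for k > n, so that the top-0 set is empty and the
   top-k set is everything for k > n. *)
Definition order_stat (R : realType) n (x : n.-tuple R) (k : nat) : \bar R :=
  nth -oo%E (+oo%E :: [seq y%:E | y <- sort (fun a b : R => b <= a) x]) k.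

Definition top_set (R : realType) n (x : n.-tuple R) (k : nat) : {set 'I_n} :=
  finset (fun i => (order_stat x k <= (tnth x i)%:E)%E).

Definition FDP (R : realType) n (H1 I : {set 'I_n}) : R :=
  #|I :&: ~: H1|%:R / (maxn #|I| 1)%:R.

Definition FNP (R : realType) n (H1 I : {set 'I_n}) : R :=
  #|~: I :&: H1|%:R / #|H1|%:R.

Definition FDR (R : realType) d (T : measurableType d) (P : probability T R)
    n (H1 : {set 'I_n}) (I : T -> {set 'I_n}) : \bar R :=
  'E_P[(fun w => FDP R H1 (I w))].

Definition FNR (R : realType) d (T : measurableType d) (P : probability T R)
    n (H1 : {set 'I_n}) (I : T -> {set 'I_n}) : \bar R :=
  'E_P[(fun w => FNP R H1 (I w))].

(* There is a top-K procedure with FDR <= alpha and FNR <= beta in the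
   Gaussian location model with signal set [H1] and shift [mu].  A randomized
   procedure is a measurable map K of the observed vector and of an auxiliary
   random element U, valued in an arbitrary measurable space and independent
   of the observations; a deterministic procedure ignores U. *)
Definition has_controlled_topK (R : realType) n (H1 : {set 'I_n})
    (mu alpha beta : R) : Prop :=
  exists (d : measure_display) (T : measurableType d) (P : probability T R)
    (W : 'I_n -> {RV P >-> R})
    (d' : measure_display) (S : measurableType d') (U : {RV P >-> S})
    (K : n.-tuple R * S -> nat),
  let X := observed H1 mu W in
  let I := fun w : T => top_set (X w) (K (X w, U w)) in
  [/\ iid_std_gaussian W,
      independent_RV2 P X U,
      measurable_fun [set: n.-tuple R * S] K,
      (FDR P H1 I <= alpha%:E)%E &
      (FNR P H1 I <= beta%:E)%E].

(* Main.v *)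
(* Fix a threshold t = x sqrt(2 log n). Whatever K is, either K is at least the
   number of statistics above t, and then every null above t is rejected, or K
   is smaller, and then every signal below t is missed. By Chebyshev's
   inequality there are about n^(1-x^2) such nulls and about m n^(-y^2) such
   signals, with y = max(sqrt r - x, 0), so FDP >~ n^(s-x^2) or
   FNP >~ n^(-y^2) with probability tending to 1. Markov's inequality excludes
   this when sqrt r - sqrt kappa_beta < x < sqrt (s + kappa_alpha), hence this
   interval must be empty. The boundary cases kappa_alpha = 0 and
   kappa_beta = 0 force c < 1 and are handled by x < sqrt s and x > sqrt r,
   where FDP and FNP tend to 1. *)

Require Import Defs.
From HB Require Import structures.
From mathcomp Require Import all_boot all_order all_algebra.
From mathcomp Require Import all_classical all_reals all_analysis.
From mathcomp Require Import measurable_realfun ring lra.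
Import Order.TTheory GRing.Theory Num.Theory.
Import numFieldNormedType.Exports.
Local Open Scope classical_set_scope.
Local Open Scope ring_scope.
Set Implicit Arguments.
Unset Strict Implicit.
Unset Printing Implicit Defensive.

(** * Variance and lower tail of a count of pairwise independent events *)

Lemma indic_Lfun2 (R : realType) d (T : measurableType d)
    (P : probability T R) (A : set T) : measurable A ->
  (\1_A : T -> R) \in Lfun P 2%:E.
Proof.
move=> mA; rewrite inE/=; apply/andP; split; rewrite inE//=.
rewrite /finite_norm unlock poweR_lty//.
under eq_integral => x _/= do rewrite powR_mulrn// ger0_norm// indicE -natrX
  -mulnn mulnb andbb -indicE.
by rewrite integral_indic// setIT (le_lt_trans (probability_le1 _ _))// ltry.
Qed.

Lemma covariance_indic (R : realType) d (T : measurableType d)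
    (P : probability T R) (A B : set T) : measurable A -> measurable B ->
  covariance P (\1_A : T -> R) (\1_B : T -> R) =
  (P (A `&` B) - P A * P B)%E.
Proof.
move=> mA mB; have P1 := fin_num_measure P _ measurableT.
have lA := indic_Lfun2 P mA; have lB := indic_Lfun2 P mB.
rewrite covarianceE ?Lfun2_mul_Lfun1 ?(Lfun_subset12 P1)//.
rewrite !expectation_indic//; congr (_ - _)%E.
by rewrite -(expectation_indic P (measurableI _ _ mA mB)) indicI.
Qed.

Lemma Lfun2_sum (R : realType) d (T : measurableType d)
    (P : probability T R) (I : Type) (s : seq I) (Q : pred I)
    (X : I -> T -> R) :
  (forall i, X i \in Lfun P 2%:E) ->
  \sum_(i <- s | Q i) X i \in Lfun P 2%:E.
Proof. by move=> lX; rewrite rpred_sum// lee1n. Qed.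

Lemma covariance_suml (R : realType) d (T : measurableType d)
    (P : probability T R) (I : Type) (s : seq I) (Q : pred I)
    (X : I -> T -> R) (Y : T -> R) :
  (forall i, X i \in Lfun P 2%:E) -> Y \in Lfun P 2%:E ->
  (covariance P (\sum_(i <- s | Q i) X i)%R Y =
   \sum_(i <- s | Q i) covariance P (X i) Y)%E.
Proof.
move=> lX lY; elim: s => [|i s IH].
  by rewrite !big_nil; exact: covariance_cst_l.
rewrite !big_cons; case: ifP => // Qi.
by rewrite covarianceDl ?IH// Lfun2_sum.
Qed.

Lemma variance_sum_uncorrelated (R : realType) d (T : measurableType d)
    (P : probability T R) (I : finType) (J : {set I}) (X : I -> T -> R) :
  (forall i, X i \in Lfun P 2%:E) ->
  {in J &, forall i j, i != j -> covariance P (X i) (X j) = 0%E} ->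
  ('V_P[(\sum_(i in J) X i)%R] = \sum_(i in J) 'V_P[X i])%E.
Proof.
move=> lX cX; rewrite /variance covariance_suml//; last exact: Lfun2_sum.
apply: eq_bigr => i iJ; rewrite covarianceC covariance_suml//.
rewrite (bigD1 i)//= big1 ?adde0// => j /andP[jJ ji].
exact: cX.
Qed.

Section count_lower_tail.
Context (R : realType) d (T : measurableType d) (P : probability T R).
Context (I : finType) (J : {set I}) (E : I -> set T) (p : R).
Hypothesis mE : forall i, measurable (E i).
Hypothesis PE : forall i, i \in J -> P (E i) = p%:E.
Hypothesis PEI : {in J &, forall i j, i != j ->
  P (E i `&` E j) = (P (E i) * P (E j))%E}.

Definition count_in (w : T) : R := \sum_(i in J) \1_(E i) w.

Lemma count_inE : count_in = \sum_(i in J) (\1_(E i) : T -> R).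
Proof. by apply/funext => w; rewrite fct_sumE. Qed.

Lemma measurable_count_in : measurable_fun [set: T] count_in.
Proof.
rewrite (_ : count_in = fun w => \sum_(i <- enum J) \1_(E i) w); last first.
  by apply/funext => w; rewrite big_enum.
by apply: measurable_sum => i; exact: measurable_indic.
Qed.

Lemma expectation_count_in : ('E_P[count_in] = (#|J|%:R * p)%:E)%E.
Proof.
rewrite unlock; under eq_integral do rewrite -sumEFin -big_enum/=.
rewrite ge0_integral_sum//; last first.
  by move=> i; apply/measurable_EFinP/measurable_indic.
rewrite big_enum/= (eq_bigr (fun=> p%:E)) => [|i iJ]; last first.
  by rewrite integral_indic// setIT; exact: PE.
by rewrite sumEFin sumr_const mulr_natl.
Qed.

(** Pairwise independence removes the covariances, and an indicator has variance [p - p^2 <= p]. *)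
Lemma variance_count_in_le : ('V_P[count_in] <= (#|J|%:R * p)%:E)%E.
Proof.
rewrite count_inE variance_sum_uncorrelated//; last 2 first.
- by move=> i; exact: indic_Lfun2.
- move=> i j iJ jJ ij; rewrite covariance_indic// PEI// subee//.
  by rewrite !PE.
rewrite mulr_natl -sumr_const -sumEFin; apply: lee_sum => i iJ.
rewrite /variance covariance_indic// setIid PE// -EFinM -EFinB lee_fin.
by rewrite gerBl -expr2 sqr_ge0.
Qed.

Lemma measurable_count_in_le (a : R) : measurable [set w | count_in w <= a].
Proof.
rewrite (_ : [set w | _] = [set: T] `&` count_in @^-1` `]-oo, a]).
  exact: measurable_count_in.
by rewrite setTI; apply/seteqP; split=> w /=; rewrite in_itv.
Qed.

(** Chebyshev's inequality at distance [delta * M] from the mean [M]: a variance of at most [M]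
    leaves [M / (delta * M)^2]. *)
Lemma count_in_lower_tail (delta : R) : 0 < delta -> 0 < #|J|%:R * p ->
  (P [set w | count_in w <= (1 - delta) * (#|J|%:R * p)]%R <=
   (delta ^+ 2 * (#|J|%:R * p))^-1%:E)%E.
Proof.
move=> d0; set M := #|J|%:R * p => M0.
pose X : {RV P >-> R} :=
  HB.pack count_in (isMeasurableFun.Build _ _ _ _ _ measurable_count_in).
have dM0 : 0 < delta * M by rewrite mulr_gt0.
have := @chebyshev _ _ _ P X _ dM0.
have -> : ('E_P[X] = M%:E)%E by exact: expectation_count_in.
rewrite /= => H.
pose Y w := `|count_in w - M|.
have mY : measurable_fun [set: T] Y.
  apply: measurableT_comp => //; apply: measurable_funB => //.
  exact: measurable_count_in.
have mYS : measurable [set w | delta * M <= Y w].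
  rewrite (_ : [set w | _] = [set: T] `&` Y @^-1` `[delta * M, +oo[).
    exact: mY.
  by rewrite setTI; apply/seteqP; split=> w /=; rewrite in_itv/= andbT.
apply: (@le_trans _ _ (P [set w | delta * M <= Y w])).
  apply: le_measure; rewrite ?inE//; first exact: measurable_count_in_le.
  move=> w /= wM; rewrite /Y ler0_norm; lra.
apply: (le_trans H); apply: (@le_trans _ _ (((delta * M) ^- 2)%:E * M%:E)%E).
  apply: lee_wpmul2l; last exact: variance_count_in_le.
  by rewrite lee_fin invr_ge0 sqr_ge0.
rewrite -EFinM lee_fin le_eqVlt; apply/orP; left; apply/eqP.
have ? : M != 0 by rewrite gt_eqF.
have ? : delta != 0 by rewrite gt_eqF.
by field; apply/andP.
Qed.
End count_lower_tail.

(** * Order statistics and thresholds *)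

(** In decreasing order the entries above [a] form a prefix, and the index [k], counted from 0, lies
    outside it exactly when its length is at most [k]. *)
Lemma sorted_nth_le_count (R : realType) (s : seq R) (k : nat) (a : R) :
  sorted (fun x y : R => y <= x) s -> (k < size s)%N ->
  (nth 0 s k <= a) = (count (fun y => a < y)%R s <= k)%N.
Proof.
elim: s k => [//|y s IH] k /= ys ks.
have ge_trans : transitive (fun x y : R => y <= x).
  by move=> u v w vu uw; exact: le_trans uw vu.
have [ya|ay] := leP y a.
  have c0 : count (fun z => a < z) s = 0%N.
    apply/eqP; rewrite -leqn0 leqNgt -has_count; apply/hasPn => z zs.
    have /allP/(_ z zs)/= zy := order_path_min ge_trans ys.
    by rewrite -leNgt (le_trans zy).
  rewrite c0/=; case: k ks => //= k ks.
  rewrite IH ?c0//; exact: path_sorted ys.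
case: k ks => [|k] ks /=; first by rewrite leNgt ay.
by rewrite IH ?add1n ?ltnS//; exact: path_sorted ys.
Qed.

(** Replaces sorting by counting strictly larger entries, which also settles ties: equal entries are
    selected together or not at all. *)
Lemma in_top_set (R : realType) n (x : n.-tuple R) (k : nat) (i : 'I_n) :
  (i \in top_set x k) = (#|[pred j | tnth x i < tnth x j]%R| < k)%N.
Proof.
rewrite inE /order_stat; case: k => [|k] /=; first by rewrite leye_eq ltn0.
rewrite ltnS; set s := sort _ _.
have -> : #|[pred j | tnth x i < tnth x j]| = count (fun y => tnth x i < y) s.
  rewrite count_sort [in RHS](_ : tval x = [seq tnth x j | j <- enum 'I_n]).
    by rewrite count_map -sum1_card -sum1_count big_enum_cond.
  by rewrite [in LHS](tuple_map_ord x).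
have sz : size s = n by rewrite size_sort size_tuple.
(* Past the end of the list [nth] returns its default -oo, and no more than [n <= k] entries can
   exceed anything. *)
have [nk|kn] := leqP n k.
  rewrite nth_default ?size_map ?sz// leNye; apply/esym.
  by rewrite (leq_trans (count_size _ _))// sz.
rewrite (nth_map 0) ?sz// lee_fin sorted_nth_le_count ?sz//.
by apply: sort_sorted => a b; exact: le_total.
Qed.

Definition above (R : realType) n (x : n.-tuple R) (t : R) : {set 'I_n} :=
  finset (fun j => t <= tnth x j).

(** An entry at or above [t] is strictly exceeded only by other members of [above x t], hence by
    fewer than [k] entries. *)
Lemma above_sub_top_set (R : realType) n (x : n.-tuple R) (k : nat) (t : R) :
  (#|above x t| <= k)%N ->
  above x t \subset top_set x k.
Proof.
move=> Nk; apply/fintype.subsetP => i; rewrite inE in_top_set => ti.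
apply: leq_trans Nk; apply: proper_card; apply/properP; split.
  by apply/fintype.subsetP => j; rewrite !inE => /ltW; exact: le_trans.
by exists i; rewrite inE// ltxx.
Qed.

(** An entry below [t] is strictly exceeded by all of [above x t], which is more than [k]
    entries. *)
Lemma top_set_sub_above (R : realType) n (x : n.-tuple R) (k : nat) (t : R) :
  (k < #|above x t|)%N ->
  top_set x k \subset above x t.
Proof.
move=> kN; apply/fintype.subsetP => i; rewrite in_top_set inE => ik.
rewrite leNgt; apply/negP => it.
have := leq_trans ik (ltnW kN); rewrite ltnNge => /negP; apply.
apply: subset_leq_card; apply/fintype.subsetP => j; rewrite !inE.
exact: lt_le_trans.
Qed.

(** * Lower bounds on FDP, FNP and expectations; independence and measurability *)

(** With [F] false discoveries there are at most [F + #|H1|] rejections, and [F / (F + #|H1|)]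
    increases with [F]. *)
Lemma FDP_ge (R : realType) n (H1 I V : {set 'I_n}) (N : R) :
  V \subset I :&: ~: H1 -> 0 < N <= #|V|%:R ->
  N / (N + #|H1|%:R) <= FDP R H1 I.
Proof.
move=> VI /andP[N0 NV]; rewrite /FDP.
have NI : N <= #|I :&: ~: H1|%:R.
  by rewrite (le_trans NV)// ler_nat subset_leq_card.
(* As [N > 0], something is rejected, so the guard against an empty discovery set drops out. *)
have I0 : (0 < #|I|)%N.
  rewrite (@leq_trans #|I :&: ~: H1|)//; last first.
    by rewrite subset_leq_card// finset.subsetIl.
  by rewrite -(ltr_nat R) (lt_le_trans N0).
rewrite (maxn_idPl I0) ler_pdivrMr; last by rewrite ltr_wpDr.
rewrite mulrAC ler_pdivlMr ?ltr0n//.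
have Ile : #|I|%:R <= #|I :&: ~: H1|%:R + #|H1|%:R :> R.
  rewrite -natrD ler_nat -(cardsID (~: H1) I) leq_add2l subset_leq_card//.
  by rewrite finset.setDE finset.setCK finset.subsetIr.
have H0 : 0 <= #|H1|%:R :> R by [].
nra.
Qed.

Lemma FNP_ge (R : realType) n (H1 I V : {set 'I_n}) (N : R) :
  V \subset ~: I :&: H1 -> N <= #|V|%:R -> N / #|H1|%:R <= FNP R H1 I.
Proof.
move=> VI NV; rewrite /FNP ler_wpM2r//.
by rewrite (le_trans NV)// ler_nat subset_leq_card.
Qed.

(* f need not be measurable: the integral of a nonnegative function is a
   supremum over simple functions below it. *)
Lemma expectation_ge_indic (R : realType) d (T : measurableType d)
    (P : probability T R) (f : T -> R) (A : set T) (a : R) :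
  measurable A -> 0 <= a -> (forall w, 0 <= f w) ->
  (forall w, A w -> a <= f w) -> (a%:E * P A <= 'E_P[f])%E.
Proof.
move=> mA a0 f0 fA; rewrite unlock ge0_integralTE//.
apply: ereal_sup_ubound; exists (scale_nnsfun (indic_nnsfun R mA) a0) => /=.
  move=> w; rewrite lee_fin /scale_nnsfun /= mindicE.
  by case: (boolP (w \in A)) => [/set_mem/fA|_]; rewrite ?mulr1 ?mulr0.
by rewrite sintegralrM /= sintegral_indic.
Qed.

Lemma count_in_card (R : realType) (T : Type) (I : finType) (J : {set I})
    (E : I -> set T) (w : T) :
  \sum_(i in J) \1_(E i) w =
  #|finset (fun i => (i \in J) && (w \in E i))|%:R :> R.
Proof.
rewrite -sum1_card natr_sum big_mkcond [RHS]big_mkcond/=.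
apply: eq_bigr => i _; rewrite inE indicE.
by case: (i \in J) => //=; case: (_ \in _).
Qed.

Lemma mutually_independent2 (R : realType) d (T : measurableType d)
    (P : probability T R) n (W : 'I_n -> {RV P >-> R}) (A : set R) :
  mutually_independent W -> measurable A ->
  forall i j, i != j -> P (W i @^-1` A `&` W j @^-1` A) =
    (P (W i @^-1` A) * P (W j @^-1` A))%E.
Proof.
move=> indW mA i j ij.
have := indW (i |: finset.set1 j)%SET (fun=> A) (fun _ _ => mA).
rewrite big_setU1 ?inE//= big_set1 => <-; congr (P _).
apply/seteqP; split=> [w [wi wj] k /=|w H]; last first.
  by split; apply: H; rewrite /= !inE eqxx ?orbT.
by rewrite !inE => /orP[] /eqP->.
Qed.

Lemma tnth_observed (R : realType) d (T : measurableType d)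
    (P : probability T R) n (H1 : {set 'I_n}) (mu : R)
    (W : 'I_n -> {RV P >-> R}) (w : T) (i : 'I_n) :
  tnth (observed H1 mu W w) i = if i \in H1 then W i w + mu else W i w.
Proof. by rewrite tnth_mktuple. Qed.

Lemma measurable_tnth_observed (R : realType) d (T : measurableType d)
    (P : probability T R) n (H1 : {set 'I_n}) (mu : R)
    (W : 'I_n -> {RV P >-> R}) (i : 'I_n) :
  measurable_fun [set: T] (fun w => tnth (observed H1 mu W w) i).
Proof.
under eq_fun do rewrite tnth_observed.
case: (i \in H1); last exact: measurable_funPT.
by apply: measurable_funD => //; exact: measurable_funPT.
Qed.

(** Both sides of the comparison are random; splitting over the countably many values of [K] leaves
    a count to compare with a constant. *)
Lemma measurable_above_le (R : realType) d (T : measurableType d)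
    n (X : T -> n.-tuple R) (K : T -> nat) (t : R) :
  (forall i, measurable_fun [set: T] (fun w => tnth (X w) i)) ->
  measurable_fun [set: T] K ->
  measurable [set w | (#|above (X w) t| <= K w)%N].
Proof.
move=> mX mK.
pose E i := [set w | t <= tnth (X w) i].
have mE i : measurable (E i).
  rewrite (_ : E i = [set: T] `&` (fun w => tnth (X w) i) @^-1` `[t, +oo[).
    exact: mX.
  by rewrite setTI; apply/seteqP; split=> w /=; rewrite in_itv/= andbT.
rewrite (_ : [set w | _] = \bigcup_k (K @^-1` [set k] `&`
    [set w | count_in R [set: 'I_n]%SET E w <= k%:R])); last first.
  have cE w : count_in R [set: 'I_n]%SET E w = #|above (X w) t|%:R.
    rewrite /count_in count_in_card; congr _%:R; apply: eq_card => i.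
    by rewrite !inE; apply/idP/idP => [/set_mem|ti]//; exact/mem_set.
  apply/seteqP; split=> [w /= wK|w [k _ [/= <-]]]; last by rewrite cE ler_nat.
  by exists (K w) => //; split => //=; rewrite cE ler_nat.
apply: bigcup_measurable => k _; apply: measurableI.
  by rewrite -[X in measurable X]setTI; exact: mK.
exact: measurable_count_in_le.
Qed.

(** * Finite-sample tradeoff between FDR and FNR *)

(* p and q are the probabilities that a given null exceeds t and that a given
   signal falls below t. *)
Section topK_tradeoff.
Context (R : realType) (n : nat) (H1 : {set 'I_n}) (mu t p q delta : R).
Hypothesis pE : normal_prob 0 1 `[t, +oo[ = p%:E.
Hypothesis qE : normal_prob 0 1 `]-oo, (t - mu)[ = q%:E.
Hypothesis delta01 : 0 < delta < 1.
Let h : R := #|~: H1|%:R.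
Let m : R := #|H1|%:R.
Hypothesis hp0 : 0 < h * p.
Hypothesis mq0 : 0 < m * q.
Let N : R := (1 - delta) * (h * p).

(** Four events cover the sample space, one per summand: too few nulls above [t]; too few signals
    below [t]; enough such nulls while [K] reaches the number of statistics above [t], which makes
    FDP large; enough such signals while [K] falls short of it, which makes FNP large. *)
Lemma topK_tradeoff (alpha beta : R) :
  has_controlled_topK H1 mu alpha beta ->
  1 <= (delta ^+ 2 * (h * p))^-1 + (delta ^+ 2 * (m * q))^-1 +
       alpha * ((N + m) / N) + beta / ((1 - delta) * q).
Proof.
have [d0 d1] := andP delta01.
have N0 : 0 < N by rewrite mulr_gt0// subr_gt0.
move=> [d [T [P [W [d' [S [U [K]]]]]]]] [[indW gaussW] indU mK leFDR leFNR].
set X := observed H1 mu W; pose k w := K (X w, U w).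
pose I w := top_set (X w) (k w).
pose E0 i := W i @^-1` `[t, +oo[; pose E1 i := W i @^-1` `]-oo, t - mu[.
have mE0 i : measurable (E0 i) by exact: measurable_funPTI.
have mE1 i : measurable (E1 i) by exact: measurable_funPTI.
have PE0 i : P (E0 i) = p%:E by rewrite -pE -(gaussW i).
have PE1 i : P (E1 i) = q%:E by rewrite -qE -(gaussW i).
pose c0 := count_in R (~: H1)%SET E0; pose c1 := count_in R H1 E1.
pose A0 := [set w | c0 w <= N].
pose A1 := [set w | c1 w <= (1 - delta) * (m * q)].
pose D := [set w | (#|above (X w) t| <= k w)%N].
have mA0 : measurable A0 by exact: measurable_count_in_le.
have mA1 : measurable A1 by exact: measurable_count_in_le.
have mX : measurable_fun [set: T] X.
  by apply/measurable_fun_tnthP => i; exact: measurable_tnth_observed.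
have mk : measurable_fun [set: T] k.
  by apply: measurableT_comp => //; exact: measurable_fun_pair.
have mD : measurable D.
  by apply: measurable_above_le => // i; exact: measurable_tnth_observed.
have PA0 : (P A0 <= ((delta ^+ 2 * (h * p))^-1)%:E)%E.
  apply: count_in_lower_tail => // i j _ _ ij.
  exact: mutually_independent2.
have PA1 : (P A1 <= ((delta ^+ 2 * (m * q))^-1)%:E)%E.
  apply: count_in_lower_tail => // i j _ _ ij.
  exact: mutually_independent2.
have aboveE w i : (i \in above (X w) t) =
    if i \in H1 then t <= W i w + mu else t <= W i w.
  by rewrite inE tnth_observed; case: (i \in H1).
have m0 : m != 0 by apply: contraTneq mq0 => ->; rewrite mul0r ltxx.
have PFD : ((N / (N + m))%:E * P (~` A0 `&` D) <= alpha%:E)%E.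
  apply: le_trans leFDR; apply: expectation_ge_indic.
  - by apply: measurableI => //; exact: measurableC.
  - by rewrite divr_ge0// ?addr_ge0// ltW.
  - by move=> w; rewrite divr_ge0.
  (* On [D] every statistic above [t] is rejected, so the nulls above [t], collected in [V], are
     false discoveries. *)
  move=> w [/= /negP + wD]; rewrite -ltNge /c0 /count_in count_in_card.
  set V := finset _ => NV; apply: (@FDP_ge _ _ _ _ V); last by rewrite N0 ltW.
  apply/fintype.subsetP => i; rewrite [i \in V]inE finset.in_setC.
  move=> /andP[iH /set_mem].
  rewrite /E0/= in_itv/= andbT => ti.
  rewrite finset.in_setI finset.in_setC iH andbT.
  apply: (fintype.subsetP (above_sub_top_set wD)).
  by rewrite aboveE (negbTE iH).
have PFN : (((1 - delta) * q)%:E * P (~` A1 `&` ~` D) <= beta%:E)%E.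
  apply: le_trans leFNR; apply: expectation_ge_indic.
  - by apply: measurableI => //; exact: measurableC.
  - rewrite mulr_ge0// ?subr_ge0 ?(ltW d1)//.
    by rewrite -lee_fin -qE.
  - by move=> w; rewrite divr_ge0.
  (* Off [D] only statistics above [t] are rejected, so the signals below [t], collected in [V], are
     missed. *)
  move=> w [/= /negP + /negP wD]; rewrite -ltNge /c1 /count_in count_in_card.
  set V := finset _ => NV.
  rewrite (_ : (1 - delta) * q = (1 - delta) * (m * q) / m); last by field.
  apply: (@FNP_ge _ _ _ _ V); last by rewrite ltW.
  apply/fintype.subsetP => i; rewrite [i \in V]inE => /andP[iH /set_mem].
  rewrite /E1/= in_itv/= => ti; rewrite finset.in_setI finset.in_setC iH andbT.
  move: wD; rewrite -ltnNge => /top_set_sub_above/fintype.subsetP/(_ i) H.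
  apply/negP => /H; rewrite aboveE iH leNgt => /negP; apply.
  by rewrite -ltrBrDr.
have PC0 : (P (~` A0 `&` D) <= (alpha * ((N + m) / N))%:E)%E.
  have NmN0 : 0 < N / (N + m) by rewrite divr_gt0// ltr_wpDr.
  by rewrite -[(_ / N)%R]invf_div EFinM lee_pdivlMr// muleC.
have PC1 : (P (~` A1 `&` ~` D) <= (beta / ((1 - delta) * q))%:E)%E.
  have q0 : 0 < q by rewrite -(pmulr_rgt0 q (_ : 0 < m))// lt0r m0 /=.
  have dq0 : 0 < (1 - delta) * q by rewrite mulr_gt0// subr_gt0.
  by rewrite EFinM lee_pdivlMr// muleC.
have cover : [set: T] `<=` A0 `|` A1 `|` (~` A0 `&` D) `|` (~` A1 `&` ~` D).
  move=> w _; have [?|?] := pselect (A0 w); first by do 3 left.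
  have [?|?] := pselect (A1 w); first by left; left; right.
  by have [?|?] := pselect (D w); [left; right|right].
have mAA : measurable (A0 `|` A1) by exact: measurableU.
have mF : measurable (~` A0 `&` D).
  by apply: measurableI => //; exact: measurableC.
have mG : measurable (~` A1 `&` ~` D) by apply: measurableI; exact: measurableC.
have mAF : measurable (A0 `|` A1 `|` (~` A0 `&` D)) by exact: measurableU.
rewrite -lee_fin !EFinD -(probability_setT P).
apply: le_trans (le_measure _ _ _ cover) _; rewrite ?inE//.
  exact: measurableU.
apply: le_trans (measureU2 _ mAF mG) _; apply: leeD => //.
apply: le_trans (measureU2 _ mAA mF) _; apply: leeD => //.
by apply: le_trans (measureU2 _ mA0 mA1) _; exact: leeD.
Qed.
End topK_tradeoff.

(** * Lower bounds for Gaussian probabilities *)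

(** Within distance [M] of 0 the density is at least the constant on the left, and the interval has
    length 1. *)
Lemma normal_prob_ge (R : realType) (A : set R) (a M : R) :
  measurable A -> `]a, (a + 1)[ `<=` A ->
  (forall x, a < x < a + 1 -> `|x| <= M) ->
  ((normal_peak 1 * expR (- (M ^+ 2 / 2)))%:E <= normal_prob 0 1 A)%E.
Proof.
move=> mA aA xM.
apply: (@le_trans _ _ (normal_prob 0 1 `]a, (a + 1)[)); last first.
  by apply: le_measure; rewrite ?inE.
rewrite /normal_prob.
apply: (@le_trans _ _ (\int[lebesgue_measure]_(x in `]a, (a + 1)%R[)
    (normal_peak 1 * expR (- (M ^+ 2 / 2)))%:E)%E).
  rewrite integral_cst//= lebesgue_measure_itv/= lte_fin ltrDl ltr01.
  by rewrite -EFinD addrAC subrr add0r mule1.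
apply: ge0_le_integral => //.
- by move=> x _; rewrite lee_fin mulr_ge0 ?normal_peak_ge0 ?expR_ge0.
- by apply/measurable_EFinP/measurable_funTS; exact: measurable_normal_pdf.
- move=> x /=; rewrite in_itv/= => /xM Mx.
  rewrite lee_fin normal_pdfE ?oner_neq0// ler_wpM2l ?normal_peak_ge0//.
  rewrite ler_expR mulNr lerN2 subr0 expr1n ler_pM2r// -(real_normK (num_real x)).
  by rewrite ler_sqr ?nnegrE// (le_trans _ Mx).
Qed.

(** For [L = ln n] the bound is of order [n^-(y^2 + eps)], with [C] independent of [L]. The unit
    interval starts at [y * sqrt (2 * L)] for an upper tail and ends at its opposite for a lower
    tail; [eps] absorbs the term of order [sqrt L]. *)
Lemma normal_tail_ge (R : realType) (y eps : R) : 0 <= y -> 0 < eps ->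
  exists2 C : R, 0 < C & forall (L a : R) (A : set R), 0 <= L ->
    measurable A -> `]a, (a + 1)[ `<=` A ->
    a = y * Num.sqrt (2 * L) \/ a = - (y * Num.sqrt (2 * L)) - 1 ->
    ((C * expR (- ((y ^+ 2 + eps) * L)))%:E <= normal_prob 0 1 A)%E.
Proof.
(* The exponent collects what does not grow with [L]: [1/2] from expanding [(y * l + 1)^2 / 2], and
   [y^2 / (2 * eps)] from bounding its cross term. *)
move=> y0 e0; exists (normal_peak 1 * expR (- (2^-1 + y ^+ 2 / (2 * eps)))).
  by rewrite mulr_gt0 ?expR_gt0// normal_peak_gt0// oner_neq0.
move=> L a A L0 mA aA aE; set l := Num.sqrt (2 * L) in aE.
have l0 : 0 <= l by rewrite sqrtr_ge0.
have l2 : l ^+ 2 = 2 * L by rewrite sqr_sqrtr// mulr_ge0.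
have yl0 : 0 <= y * l by rewrite mulr_ge0.
apply: le_trans (@normal_prob_ge _ A a (y * l + 1) mA aA _); last first.
  move=> x /andP[ax xa]; rewrite ler_norml.
  by apply/andP; case: aE => aE; split; lra.
rewrite lee_fin -mulrA ler_wpM2l ?normal_peak_ge0// -expRD ler_expR.
(* AM-GM *)
have ylL : y * l <= eps * L + y ^+ 2 / (2 * eps).
  have -> : eps * L + y ^+ 2 / (2 * eps) =
      y * l + (eps * l - y) ^+ 2 / (2 * eps).
    have -> : L = l ^+ 2 / 2 by rewrite l2; field.
    by field; rewrite gt_eqF.
  by rewrite lerDl divr_ge0 ?sqr_ge0// mulr_ge0// ltW.
have -> : (y * l + 1) ^+ 2 / 2 = y ^+ 2 * L + y * l + 2^-1.
  have -> : L = l ^+ 2 / 2 by rewrite l2; field.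
  by field.
lra.
Qed.

(** Continuity from below along the half-lines ending at the natural numbers. *)
Lemma normal_prob_near1 (R : realType) (e : R) : 0 < e ->
  exists z : R, ((1 - e)%:E <= normal_prob 0 1 `]-oo, z[)%E.
Proof.
move=> e0.
pose F (n : nat) : set R := [set` `]-oo, n%:R[].
have F1 : normal_prob (0 : R) 1 (\bigcup_n F n) = 1%E.
  rewrite (_ : \bigcup_n F n = [set: R]); first exact: probability_setT.
  rewrite -subTset => x _; exists (Num.truncn x).+1 => //.
  by rewrite /F/= in_itv/= truncnS_gt.
have : normal_prob (0 : R) 1 \o F @ \oo --> normal_prob (0 : R) 1 (\bigcup_n F n).
  have mF k : measurable (F k) by exact: measurable_itv.
  have mUF : measurable (\bigcup_n F n) by apply: bigcup_measurable.
  apply: nondecreasing_cvg_mu => //.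
  move=> n k nk; apply/subsetPset => x; rewrite /F/= !in_itv/= => /lt_le_trans.
  by apply; rewrite ler_nat.
rewrite F1 => /fine_cvgP[_] /cvgrPdist_lt/(_ e e0)[n _ /(_ n (leqnn n))] /=.
rewrite ltr_norml => /andP[_ H].
exists n%:R; rewrite -(fineK (fin_num_measure (normal_prob 0 1) (F n) _)).
  by rewrite lee_fin; lra.
exact: measurable_itv.
Qed.

(** * Powers of [n] as exponentials of [ln n] *)

Lemma near_ln_ge (R : realType) (M : R) : \forall n \near \oo, M <= ln n%:R.
Proof.
near=> n; have eMn : expR M <= n%:R by near: n; exact: nbhs_infty_ger.
by rewrite -ler_expR lnK// posrE (lt_le_trans (expR_gt0 M)).
Unshelve. all: by end_near. Qed.

(** By [expR x >= x], it suffices that [ln n] exceeds [|D| / (a * eta)]. *)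
Lemma near_expR_ln_le (R : realType) (D a eta : R) : 0 < a -> 0 < eta ->
  \forall n \near \oo, D * expR (- (a * ln n%:R)) <= eta.
Proof.
move=> a0 e0; near=> n.
have : `|D| / (a * eta) <= ln n%:R by near: n; exact: near_ln_ge.
rewrite ler_pdivrMr ?mulr_gt0// => DL.
rewrite expRN ler_pdivrMr ?expR_gt0//.
apply: (@le_trans _ _ (eta * (a * ln n%:R))).
  rewrite (_ : eta * _ = ln n%:R * (a * eta)); last by ring.
  exact: le_trans (ler_norm D) DL.
rewrite ler_pM2l//; apply: le_trans (expR_ge1Dx _).
by rewrite lerDr ler01.
Unshelve. all: by end_near. Qed.

Lemma powR_expR_ln (R : realType) (n : nat) (a : R) : (0 < n)%N ->
  n%:R `^ a = expR (a * ln n%:R).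
Proof. by move=> n0; rewrite /powR pnatr_eq0 gtn_eqF. Qed.

(** * Inequalities between exponents *)

(* The interval for x also stays above sqrt r - sqrt (1 - s), so that the
   expected number m n^(-y^2) of missed signals diverges. *)
Lemma exponents_exist (R : realType) (s r ka kb : R) :
  0 < s -> s < r -> r < 1 -> 0 <= ka -> 0 <= kb ->
  Num.sqrt r < Num.sqrt (s + ka) + Num.sqrt kb ->
  exists x y eps : R, [/\ 0 <= x /\ 0 <= y, 0 < eps,
    Num.sqrt r - x <= y,
    [/\ x ^+ 2 + eps < 1, s + y ^+ 2 + eps < 1 & x ^+ 2 + eps < s + ka] &
    (kb = 0 -> Num.sqrt r < x) /\ (0 < kb -> y ^+ 2 + eps < kb)].
Proof.
move=> s0 sr r1 ka0 kb0; set v := Num.sqrt r; set u := Num.sqrt (s + ka).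
set w := Num.sqrt kb => vuw.
have r0 : 0 <= r by lra.
have v1 : v < 1 by rewrite -sqrtr1 ltr_sqrt.
have v0 : 0 <= v by exact: sqrtr_ge0.
have w0 : 0 <= w by exact: sqrtr_ge0.
have u2 : u ^+ 2 = s + ka by rewrite sqr_sqrtr//; lra.
have w2 : w ^+ 2 = kb by rewrite sqr_sqrtr.
have u0 : 0 < u by rewrite sqrtr_gt0; lra.
set z := Num.sqrt (1 - s).
have z0 : 0 < z by rewrite sqrtr_gt0; lra.
have z2 : z ^+ 2 = 1 - s by rewrite sqr_sqrtr//; lra.
(* Since [u^2 + z^2 = 1 + ka], the sum [u + z] is at least 1, whereas [v < 1]. *)
have vuz : v < u + z.
  have uz : 1 <= (u + z) ^+ 2 by nra.
  rewrite (lt_le_trans v1)// -(@ler_sqr _ 1) ?nnegrE//; first by rewrite expr1n.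
  by rewrite addr_ge0// ltW.
(* The lower end gives [y < z], and [y < w] when [w > 0]; the upper end keeps [x^2] below both
   [s + ka] and 1. *)
pose lo := Num.max (Num.max (v - w) (v - z)) 0; pose hi := Num.min u 1.
have lohi : lo < hi.
  rewrite /lo /hi !gt_max !lt_min u0 ltr01 !andbT.
  by apply/andP; split; apply/andP; split; lra.
pose x := (lo + hi) / 2; pose y := Num.max (v - x) 0.
have lox : lo < x by rewrite /x; lra.
have xhi : x < hi by rewrite /x; lra.
have : lo < x by []; rewrite /lo !gt_max => /andP[/andP[vwx vzx] x0].
have : x < hi by []; rewrite /hi lt_min => /andP[xu x1].
have y0 : 0 <= y by rewrite le_max lexx orbT.
have yz : y < z by rewrite gt_max z0 andbT; lra.
have ux2 : x ^+ 2 < s + ka by rewrite -u2 ltr_sqr ?nnegrE ?ltW.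
have x12 : x ^+ 2 < 1 by rewrite -(expr1n _ 2%N) ltr_sqr ?nnegrE ?ltW.
have yz2 : y ^+ 2 < 1 - s by rewrite -z2 ltr_sqr ?nnegrE// ltW.
pose e0 := Num.min (Num.min (1 - x ^+ 2) (1 - s - y ^+ 2)) (s + ka - x ^+ 2).
(* For [kb = 0] there is no room between [y^2] and [kb]; then [w = 0] and the lower end gives
   [x > v] instead. *)
pose e := if 0 < kb then Num.min e0 (kb - y ^+ 2) else e0.
have ykb : 0 < kb -> y ^+ 2 < kb.
  move=> kb1; have w1 : 0 < w by rewrite sqrtr_gt0.
  rewrite -w2 ltr_sqr ?nnegrE// gt_max w1 andbT; lra.
have e00 : 0 < e0.
  by rewrite /e0 !lt_min; apply/andP; split; [apply/andP; split|]; lra.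
have egt0 : 0 < e.
  by rewrite /e; case: ifP => // kb1; rewrite lt_min e00 subr_gt0 ykb.
have ee0 : e <= e0 by rewrite /e; case: ifP => // _; rewrite ge_min lexx.
have : e <= e0 by []; rewrite /e0 !le_min => /andP[/andP[e1 e2] e3].
exists x, y, (e / 2); split => //.
- by split => //; exact: ltW.
- by rewrite divr_gt0.
- by rewrite /y le_max lexx.
- by split; lra.
split=> [kb_eq0|kb1].
  by move: vwx; rewrite /w kb_eq0 sqrtr0 subr0.
have : e <= kb - y ^+ 2 by rewrite /e kb1 ge_min lexx orbT.
lra.
Qed.

(** With both exponents lowered to their minimum [k], squaring [sqrt (s + k) <= sqrt r - sqrt k]
    cancels [k] and leaves [2 * sqrt (r * k) <= r - s]; squaring again gives the bound. *)
Lemma min_exponent_le (R : realType) (s r ka kb : R) :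
  0 < s -> s < r -> 0 <= ka -> 0 <= kb ->
  Num.sqrt (s + ka) + Num.sqrt kb <= Num.sqrt r ->
  Num.min ka kb <= (r - s) ^+ 2 / (4 * r).
Proof.
move=> s0 sr ka0 kb0 H; have r0 : 0 < r by lra.
set k := Num.min ka kb.
have k0 : 0 <= k by rewrite le_min ka0.
have kka : k <= ka by rewrite ge_min lexx.
have kkb : k <= kb by rewrite ge_min lexx orbT.
have {H} : Num.sqrt (s + k) + Num.sqrt k <= Num.sqrt r.
  by apply: le_trans H; rewrite lerD// ler_wsqrtr// lerD2l.
set u := Num.sqrt (s + k); set w := Num.sqrt k; set v := Num.sqrt r => H.
have u2 : u ^+ 2 = s + k by rewrite sqr_sqrtr//; lra.
have w2 : w ^+ 2 = k by rewrite sqr_sqrtr.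
have v2 : v ^+ 2 = r by rewrite sqr_sqrtr//; lra.
have u0 : 0 <= u by exact: sqrtr_ge0.
have v0 : 0 <= v by exact: sqrtr_ge0.
have w0 : 0 <= w by exact: sqrtr_ge0.
have vw : 2 * (v * w) <= r - s.
  have : u ^+ 2 <= (v - w) ^+ 2 by rewrite ler_sqr ?nnegrE//; lra.
  by rewrite sqrrB u2 v2 w2; lra.
rewrite ler_pdivlMr ?mulr_gt0//.
have -> : k * (4 * r) = (2 * (v * w)) ^+ 2 by rewrite -w2 -v2; ring.
by rewrite ler_sqr ?nnegrE ?mulr_ge0//; lra.
Qed.

(** * Limits of the levels, and sizes of the two groups *)

(** A negative [k] would make the level diverge, and for [k = 0] the level is the constant [c]. *)
Lemma near_rate_lt1 (R : realType) (c k : R) : 0 < c ->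
  (\forall n \near \oo, c * n%:R `^ (- k) < 1) -> 0 <= k /\ (k = 0 -> c < 1).
Proof.
move=> c0 ck1; split=> [|k0]; last first.
  near \oo => n; have : c * n%:R `^ (- k) < 1 by near: n.
  by rewrite k0 oppr0 powRr0 mulr1.
rewrite leNgt; apply/negP => k0; near \oo => n.
have n0 : (0 < n)%N by near: n; exact: nbhs_infty_gt.
have : c * n%:R `^ (- k) < 1 by near: n.
have : 1 * expR (- (- k * ln n%:R)) <= c.
  by near: n; apply: near_expR_ln_le => //; rewrite oppr_gt0.
rewrite powR_expR_ln// mul1r expRN => ec.
rewrite ltNge => /negP; apply.
by rewrite -ler_pdivrMr ?expR_gt0// mul1r.
Unshelve. all: by end_near. Qed.

(** A fixed gap below 1 leaves room for vanishing error terms: the level is [c] itself when [k = 0]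
    and tends to 0 otherwise. *)
Lemma near_rate_le (R : realType) (c k : R) : 0 < c -> 0 <= k ->
  (k = 0 -> c < 1) ->
  exists2 c' : R, c' < 1 & \forall n \near \oo, c * n%:R `^ (- k) <= c'.
Proof.
move=> c0; rewrite le_eqVlt => /predU1P[<- /(_ erefl) c1|k0 _].
  by exists c => //; near=> n; rewrite oppr0 powRr0 mulr1.
exists 2^-1; first by rewrite invf_lt1// ltr1n.
near=> n; have n0 : (0 < n)%N by near: n; exact: nbhs_infty_gt.
rewrite powR_expR_ln// mulNr; near: n.
by apply: near_expR_ln_le.
Unshelve. all: by end_near. Qed.

Lemma near_sqrt_ln_ge (R : realType) (M : R) :
  \forall n \near \oo, M <= Num.sqrt (2 * ln n%:R).
Proof.
near=> n; have : M ^+ 2 <= ln n%:R by near: n; exact: near_ln_ge.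
move=> ML; rewrite (le_trans (ler_norm M))// -sqrtr_sqr ler_wsqrtr//.
have := sqr_ge0 M; lra.
Unshelve. all: by end_near. Qed.

(* q n stands for the probability that a signal falls below the threshold; it
   tends to 1 when kb = 0 and is at least of order n^(-(y^2+eps)) otherwise. *)
Lemma near_total_rate (R : realType) (c ka kb y eps C : R) (q : nat -> R) :
  0 < c -> 0 <= ka -> 0 <= kb -> (ka = 0 -> c < 1) -> (kb = 0 -> c < 1) ->
  0 < ka + kb -> 0 < C ->
  (forall n, (0 < n)%N -> C * expR (- ((y ^+ 2 + eps) * ln n%:R)) <= q n) ->
  (kb = 0 -> forall e, 0 < e -> \forall n \near \oo, 1 - e <= q n) ->
  (0 < kb -> y ^+ 2 + eps < kb) ->
  exists delta c1 : R, [/\ 0 < delta < 1, c1 < 1 & \forall n \near \oo,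
    c * n%:R `^ (- ka) + c * n%:R `^ (- kb) / ((1 - delta) * q n) <= c1].
Proof.
move=> c0 ka0 kb0 cka ckb kakb C0 qC q1 ykb.
have q0 n : (0 < n)%N -> 0 < q n.
  by move=> n0; apply: lt_le_trans (qC n n0); rewrite mulr_gt0 ?expR_gt0.
have [kbE|kbN0] := eqVneq kb 0.
  have c1 := ckb kbE; have ka1 : 0 < ka by rewrite kbE addr0 in kakb.
  (* Chosen so that [1 + c = 2 - 4 * delta <= 2 * (1 - delta)^2], which yields
     [c / (1 - delta)^2 <= c2 < 1]; one factor [1 - delta] bounds [q n] from below. *)
  pose delta : R := (1 - c) / 4; pose c2 := 2 * c / (1 + c).
  have d01 : 0 < delta < 1 by apply/andP; split; rewrite /delta; lra.
  have c2c : c / (1 - delta) ^+ 2 <= c2.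
    rewrite /c2 ler_pdivrMr; last by rewrite exprn_gt0//; lra.
    rewrite mulrAC ler_pdivlMr; last by lra.
    rewrite [2 * c]mulrC -mulrA ler_pM2l//.
    have := sqr_ge0 delta; rewrite (_ : 1 + c = 2 - 4 * delta); last first.
      by rewrite /delta; field.
    by nra.
  have c21 : c2 < 1 by rewrite /c2 ltr_pdivrMr; lra.
  exists delta, ((1 + c2) / 2); split => //; first by lra.
  near=> n; have n0 : (0 < n)%N by near: n; exact: nbhs_infty_gt.
  have qd : 1 - delta <= q n by near: n; apply: (q1 kbE); case/andP: d01.
  have a1 : c * expR (- (ka * ln n%:R)) <= (1 - c2) / 2.
    by near: n; apply: near_expR_ln_le => //; rewrite divr_gt0// subr_gt0.
  rewrite !powR_expR_ln// kbE oppr0 mul0r expR0 mulr1 mulNr.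
  suff : c / ((1 - delta) * q n) <= c2 by lra.
  apply: le_trans c2c; rewrite ler_pM2l// lef_pV2 ?posrE.
  - by rewrite expr2 ler_pM2l//; lra.
  - by rewrite mulr_gt0 ?q0//; lra.
  - by rewrite exprn_gt0//; lra.
have kb1 : 0 < kb by rewrite lt0r kbN0.
have [c' c'1 near_c'] := near_rate_le c0 ka0 cka.
(* The second term now vanishes for any fixed [delta], because [y^2 + eps < kb]; it only has to fit
   in half the gap between [c'] and 1. *)
exists 2^-1, ((1 + c') / 2); split; [by apply/andP; split; lra|by lra|].
near=> n; have n0 : (0 < n)%N by near: n; exact: nbhs_infty_gt.
have a1 : c * n%:R `^ (- ka) <= c' by near: n.
have b1 : (2 * c / C) * expR (- ((kb - (y ^+ 2 + eps)) * ln n%:R)) <=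
    (1 - c') / 2.
  near: n; apply: near_expR_ln_le; first by rewrite subr_gt0 ykb.
  by rewrite divr_gt0// subr_gt0.
suff : c * n%:R `^ (- kb) / ((1 - 2^-1) * q n) <=
    (2 * c / C) * expR (- ((kb - (y ^+ 2 + eps)) * ln n%:R)) by lra.
rewrite ler_pdivrMr; last by rewrite mulr_gt0 ?q0//; lra.
rewrite powR_expR_ln//.
have -> : expR (- kb * ln n%:R) = expR (- ((kb - (y ^+ 2 + eps)) * ln n%:R)) *
    expR (- ((y ^+ 2 + eps) * ln n%:R)) by rewrite -expRD; congr expR; ring.
set e1 := expR _; have := qC n n0; set e2 := expR _ => Ce2.
have -> : c * (e1 * e2) = 2 * c / C * e1 * (2^-1 * (C * e2)).
  by field; rewrite gt_eqF.
rewrite ler_wpM2l//; first by rewrite !mulr_ge0// ?expR_ge0 ?invr_ge0// ltW.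
lra.
Unshelve. all: by end_near. Qed.

(** Once [E = n^(1-s)] is at least 2, an error below 1 costs at most a factor 2; once [n^s >= 4],
    the signals number at most [2 * E <= n / 2]. *)
Lemma signal_null_counts (R : realType) (n : nat) (H1 : {set 'I_n}) (s : R) :
  (0 < n)%N -> `|#|H1|%:R - n%:R `^ (1 - s)| < 1 ->
  2 * expR (- ((1 - s) * ln n%:R)) <= 1 -> 4 * expR (- (s * ln n%:R)) <= 1 ->
  [/\ expR ((1 - s) * ln n%:R) / 2 <= #|H1|%:R :> R,
      #|H1|%:R <= 2 * expR ((1 - s) * ln n%:R) :> R &
      expR (ln n%:R) / 2 <= #|~: H1|%:R :> R].
Proof.
move=> n0; rewrite powR_expR_ln//; set E := expR ((1 - s) * _).
have E0 : 0 < E by exact: expR_gt0.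
rewrite ltr_norml => /andP[mE Em].
move=> E2 s4; have {}E2 : 2 <= E by move: E2; rewrite expRN ler_pdivrMr// mul1r.
have nE : E * expR (s * ln n%:R) = expR (ln n%:R).
  by rewrite -expRD; congr expR; ring.
have S0 : 0 < expR (s * ln n%:R) :> R by exact: expR_gt0.
have S4 : 4 <= expR (s * ln n%:R) :> R.
  by move: s4; rewrite expRN ler_pdivrMr// mul1r.
have hm : #|H1|%:R + #|~: H1|%:R = expR (ln n%:R) :> R.
  by rewrite -natrD cardsC card_ord lnK// posrE ltr0n.
split; [lra|lra|].
have : 4 * E <= expR (ln n%:R) by rewrite -nE mulrC ler_pM2l.
lra.
Qed.

Lemma inv_le_expRN (R : realType) (k D a X : R) : 0 < k -> 0 < D ->
  D * expR a <= X -> (k * X)^-1 <= (k * D)^-1 * expR (- a).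
Proof.
move=> k0 D0 DX; have De0 : 0 < D * expR a by rewrite mulr_gt0 ?expR_gt0.
rewrite expRN -invfM -mulrA lef_pV2 ?posrE ?ler_pM2l ?mulr_gt0 ?expR_gt0//.
exact: lt_le_trans DX.
Qed.

(** * The tradeoff at threshold [x * sqrt (2 * ln n)] as [n] grows *)

Lemma sqrt_exponents_le (R : realType) (s r kappa_alpha kappa_beta : R)
    (H1 : forall n : nat, {set 'I_n})
    (s_gt0 : 0 < s) (s_lt_r : s < r) (r_lt1 : r < 1)
    (card_H1 : forall n : nat, (1 <= n)%N ->
      `| #|H1 n|%:R - n%:R `^ (1 - s) | < 1) (c : R) :
  0 < c -> 0 <= kappa_alpha -> 0 <= kappa_beta ->
  (kappa_alpha = 0 -> c < 1) -> (kappa_beta = 0 -> c < 1) ->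
  (forall n : nat, (1 <= n)%N ->
    has_controlled_topK (H1 n) (Num.sqrt (2 * r * ln n%:R))
      (c * n%:R `^ (- kappa_alpha)) (c * n%:R `^ (- kappa_beta))) ->
  Num.sqrt (s + kappa_alpha) + Num.sqrt kappa_beta <= Num.sqrt r.
Proof.
set ka := kappa_alpha; set kb := kappa_beta.
move=> c0 ka0 kb0 cka ckb ctrl; rewrite leNgt; apply/negP => lt_r.
have [x [y [eps [[x0 y0] e0 vxy [xe1 ye1 xeka] [vx ykb]]]]] :=
  exponents_exist s_gt0 s_lt_r r_lt1 ka0 kb0 lt_r.
set v := Num.sqrt r in lt_r vxy vx.
(* If both exponents vanished, [lt_r] would read [sqrt r < sqrt s]. *)
have kakb : 0 < ka + kb.
  rewrite lt0r addr_ge0// andbT; apply/eqP => kakb0.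
  have [ka00 kb00] : ka = 0 /\ kb = 0 by split; lra.
  move: lt_r; rewrite ka00 kb00 addr0 sqrtr0 addr0 ltr_sqrt; lra.
pose l n : R := Num.sqrt (2 * ln n%:R).
have muE n : Num.sqrt (2 * r * ln n%:R) = v * l n.
  by rewrite /v /l -sqrtrM; [congr Num.sqrt; ring|lra].
pose p n := fine (normal_prob (0 : R) 1 `[(x * l n), +oo[).
pose q n := fine (normal_prob (0 : R) 1 `]-oo, (x * l n - v * l n)[).
have pE n : normal_prob (0 : R) 1 `[(x * l n), +oo[ = (p n)%:E.
  by rewrite fineK// fin_num_measure//; exact: measurable_itv.
have qE n : normal_prob (0 : R) 1 `]-oo, (x * l n - v * l n)[ = (q n)%:E.
  by rewrite fineK// fin_num_measure//; exact: measurable_itv.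
have [C C0 tailC] := normal_tail_ge x0 e0.
have [C' C'0 tailC'] := normal_tail_ge y0 e0.
have ln_ge0n n : (0 < n)%N -> 0 <= ln n%:R :> R.
  by move=> n0; rewrite ln_ge0// ler1n.
have pC n : (0 < n)%N -> C * expR (- ((x ^+ 2 + eps) * ln n%:R)) <= p n.
  move=> n0; rewrite -lee_fin -pE.
  apply: tailC (ln_ge0n _ n0) _ _ (or_introl erefl).
    exact: measurable_itv.
  by move=> z /=; rewrite !in_itv/= andbT => /andP[/ltW].
have qC n : (0 < n)%N -> C' * expR (- ((y ^+ 2 + eps) * ln n%:R)) <= q n.
  move=> n0; rewrite -lee_fin -qE.
  apply: tailC' (ln_ge0n _ n0) _ _ (or_intror erefl).
    exact: measurable_itv.
  (* The unit interval ends at [- (y * l n)], which is at most [(x - v) * l n] because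
     [v - x <= y]. *)
  move=> z /=; rewrite !in_itv/= subrK => /andP[_ zy]; rewrite (lt_le_trans zy)//.
  rewrite -mulrBl -mulNr ler_wpM2r ?sqrtr_ge0//; lra.
(* Here [x > v], so the endpoint [(x - v) * l n] tends to infinity. *)
have q1 : kb = 0 -> forall e, 0 < e -> \forall n \near \oo, 1 - e <= q n.
  move=> kb00 e e1; have [z ze] := normal_prob_near1 e1.
  near=> n; rewrite -lee_fin -qE; apply: le_trans ze _.
  apply: le_measure; rewrite ?inE//; try exact: measurable_itv.
  move=> w /=; rewrite !in_itv/= => wz; rewrite (lt_le_trans wz)//.
  rewrite -mulrBl -ler_pdivrMl ?subr_gt0 ?vx//.
  by near: n; exact: near_sqrt_ln_ge.
have [delta [c1 [d01 c11 near_c1]]] :=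
  near_total_rate c0 ka0 kb0 cka ckb kakb C'0 qC q1 ykb.
have [d0 d1] := andP d01.
(* Three error terms of at most [eta] each, added to [c1], stay below 1. *)
pose eta := (1 - c1) / 4; have eta0 : 0 < eta by rewrite divr_gt0// subr_gt0.
near \oo => n; have n0 : (0 < n)%N by near: n; exact: nbhs_infty_gt.
have b2 : 2 * expR (- ((1 - s) * ln n%:R)) <= 1.
  by near: n; apply: near_expR_ln_le => //; lra.
have b4 : 4 * expR (- (s * ln n%:R)) <= 1 by near: n; apply: near_expR_ln_le.
(* The choice of [x], [y] and [eps] makes the next three rates positive; these bounds feed [T1],
   [T2] and [T3]. *)
have bh : (delta ^+ 2 * (C / 2))^-1 *
    expR (- ((1 - x ^+ 2 - eps) * ln n%:R)) <= eta.
  by near: n; apply: near_expR_ln_le => //; lra.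
have bm : (delta ^+ 2 * (C' / 2))^-1 *
    expR (- ((1 - s - y ^+ 2 - eps) * ln n%:R)) <= eta.
  by near: n; apply: near_expR_ln_le => //; lra.
have bN : (c * 2 * ((1 - delta) * (C / 2))^-1) *
    expR (- ((s + ka - x ^+ 2 - eps) * ln n%:R)) <= eta.
  by near: n; apply: near_expR_ln_le => //; lra.
have btot : c * n%:R `^ (- ka) + c * n%:R `^ (- kb) / ((1 - delta) * q n) <= c1.
  by near: n.
have [mE1 mE2 hE] := signal_null_counts n0 (card_H1 n n0) b2 b4.
have p0 : 0 < p n by apply: lt_le_trans (pC n n0); rewrite mulr_gt0 ?expR_gt0.
have q0 : 0 < q n by apply: lt_le_trans (qC n n0); rewrite mulr_gt0 ?expR_gt0.
have {}pC := pC n n0; have {}qC := qC n n0; have {}ctrl := ctrl n n0.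
rewrite muE in ctrl.
set L : R := ln n%:R in b2 b4 bh bm bN mE1 mE2 hE pC qC.
set h : R := #|~: H1 n|%:R in hE; set m : R := #|H1 n|%:R in mE1 mE2.
have m0 : 0 < m by apply: lt_le_trans mE1; rewrite divr_gt0 ?expR_gt0.
have h0 : 0 < h by apply: lt_le_trans hE; rewrite divr_gt0 ?expR_gt0.
have hpE : C / 2 * expR ((1 - x ^+ 2 - eps) * L) <= h * p n.
  rewrite (_ : C / 2 * _ = expR L / 2 * (C * expR (- ((x ^+ 2 + eps) * L)))).
    by rewrite ler_pM ?mulr_ge0 ?expR_ge0// ltW.
  rewrite (_ : (1 - x ^+ 2 - eps) * L = L + - ((x ^+ 2 + eps) * L)); last by ring.
  by rewrite expRD; field.
have mqE : C' / 2 * expR ((1 - s - y ^+ 2 - eps) * L) <= m * q n.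
  rewrite (_ : C' / 2 * _ =
      expR ((1 - s) * L) / 2 * (C' * expR (- ((y ^+ 2 + eps) * L)))).
    by rewrite ler_pM ?mulr_ge0 ?expR_ge0// ltW.
  rewrite (_ : (1 - s - y ^+ 2 - eps) * L =
      (1 - s) * L + - ((y ^+ 2 + eps) * L)); last by ring.
  by rewrite expRD; field.
have dd0 : 0 < delta ^+ 2 by rewrite exprn_gt0.
have d10 : 0 < 1 - delta by rewrite subr_gt0.
have C20 : 0 < C / 2 by rewrite divr_gt0.
have C'20 : 0 < C' / 2 by rewrite divr_gt0.
have := topK_tradeoff (pE n) (qE n) d01 (mulr_gt0 h0 p0) (mulr_gt0 m0 q0) ctrl.
rewrite -/h -/m.
have T1 := le_trans (inv_le_expRN dd0 C20 hpE) bh.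
have T2 := le_trans (inv_le_expRN dd0 C'20 mqE) bm.
set N := (1 - delta) * (h * p n).
have N0 : 0 < N by rewrite !mulr_gt0.
set alpha := c * n%:R `^ (- ka) in btot ctrl *.
(* The ratio [m / N] is at most of order [n^(x^2 + eps - s)], and the factor [n^(-ka)] of [alpha]
   makes the total exponent negative. *)
have T3 : alpha * (m / N) <= eta.
  apply: le_trans bN.
  rewrite (_ : c * 2 * _ * _ = (c * expR (- ka * L)) *
      ((2 * expR ((1 - s) * L)) *
       (((1 - delta) * (C / 2))^-1 * expR (- ((1 - x ^+ 2 - eps) * L))))).
    rewrite /alpha powR_expR_ln// ler_wpM2l ?mulr_ge0 ?expR_ge0// ?(ltW c0)//.
    rewrite ler_pM ?invr_ge0 ?(ltW m0) ?(ltW N0)//.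
    exact: inv_le_expRN d10 C20 hpE.
  rewrite (_ : - ((s + ka - x ^+ 2 - eps) * L) = - ka * L + (1 - s) * L
      + - ((1 - x ^+ 2 - eps) * L)); last by ring.
  by rewrite !expRD; ring.
have -> : alpha * ((N + m) / N) = alpha + alpha * (m / N).
  by field; rewrite gt_eqF.
have etaE : 4 * eta = 1 - c1 by rewrite /eta; field.
lra.
Unshelve. all: by end_near. Qed.

Theorem corollary1 (R : realType) (s r kappa_alpha kappa_beta : R)
    (H1 : forall n : nat, {set 'I_n})
    (s_gt0 : 0 < s) (s_lt_r : s < r) (r_lt1 : r < 1)
    (card_H1 : forall n : nat, (1 <= n)%N ->
      `| #|H1 n|%:R - n%:R `^ (1 - s) | < 1)
    (controlled : exists c : R,
      [/\ 0 < c,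
          \forall n \near \oo,
            c * n%:R `^ (- kappa_alpha) < 1 /\ c * n%:R `^ (- kappa_beta) < 1 &
          forall n : nat, (1 <= n)%N ->
            has_controlled_topK (H1 n) (Num.sqrt (2 * r * ln n%:R))
              (c * n%:R `^ (- kappa_alpha)) (c * n%:R `^ (- kappa_beta))]) :
  Num.sqrt (s + kappa_alpha) + Num.sqrt kappa_beta <= Num.sqrt r /\
  Num.min kappa_alpha kappa_beta <= (r - s) ^+ 2 / (4 * r).
Proof.
have [c [c0 rates ctrl]] := controlled.
have [ka0 cka] : 0 <= kappa_alpha /\ (kappa_alpha = 0 -> c < 1).
  by apply: near_rate_lt1 => //; apply: filterS rates => n [].
have [kb0 ckb] : 0 <= kappa_beta /\ (kappa_beta = 0 -> c < 1).
  by apply: near_rate_lt1 => //; apply: filterS rates => n [].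
have H : Num.sqrt (s + kappa_alpha) + Num.sqrt kappa_beta <= Num.sqrt r.
  exact: (sqrt_exponents_le s_gt0 s_lt_r r_lt1 card_H1 c0 ka0 kb0 cka ckb ctrl).
by split => //; exact: min_exponent_le H.
Qed.
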